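(* Let $n\ge1$ and let $\mathcal{L}\subseteq\mathbb{M}_n$ be a transitive linear subspace. Let $r$ be the minimal rank of the nonzero elements of $\mathcal{L}$ and let $s$ be the largest rank of the singular elements of $\mathcal{L}$. Then $r+s\ge n$.
   Context: $\mathbb{M}_n$ is the space of $n\times n$ complex matrices acting on $\mathbb{C}^n$. A linear subspace $\mathcal{L}\subseteq\mathbb{M}_n$ is transitive if for every nonzero $x\in\mathbb{C}^n$ and every $y\in\mathbb{C}^n$ there is $A\in\mathcal{L}$ with $Ax=y$. Singular means non-invertible; in particular the zero matrix is a singular element of $\mathcal{L}$, of rank $0$. *)

(* Defs.v *)
From HB Require Import structures.
From mathcomp Require Import all_boot all_order all_algebra.
From mathcomp Require Import complex.
From mathcomp Require Import reals.
Set Implicit Arguments. Unset Strict Implicit. Unset Printing Implicit Defensive.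
Import Order.TTheory GRing.Theory Num.Theory.
Local Open Scope ring_scope.

(* R[i], for R a field of real numbers, is the field of complex numbers.
   Matrices act on column vectors. *)

Definition transitive_space (R : realType) (n : nat)
    (L : {vspace 'M[R[i]]_n}) : Prop :=
  forall x : 'cV[R[i]]_n, x != 0 ->
  forall y : 'cV[R[i]]_n, exists2 A : 'M[R[i]]_n, A \in L & A *m x = y.

Definition is_min_nonzero_rank (R : realType) (n : nat)
    (L : {vspace 'M[R[i]]_n}) (r : nat) : Prop :=
  (exists A : 'M[R[i]]_n, [/\ A \in L, A != 0 & \rank A = r]) /\
  (forall A : 'M[R[i]]_n, A \in L -> A != 0 -> (r <= \rank A)%N).

(* 0 counts as singular, of rank 0, when n >= 1. *)
Definition is_max_singular_rank (R : realType) (n : nat)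
    (L : {vspace 'M[R[i]]_n}) (s : nat) : Prop :=
  (exists A : 'M[R[i]]_n, [/\ A \in L, A \notin unitmx & \rank A = s]) /\
  (forall A : 'M[R[i]]_n, A \in L -> A \notin unitmx -> (\rank A <= s)%N).

(* Main.v *)
Require Import Defs.
From HB Require Import structures.
From mathcomp Require Import all_boot all_order all_algebra.
From mathcomp Require Import complex.
From mathcomp Require Import reals.
Set Implicit Arguments. Unset Strict Implicit. Unset Printing Implicit Defensive.
Import Order.TTheory GRing.Theory Num.Theory.
Local Open Scope ring_scope.

(** Let A be an element of rank r of a transitive space L of n x n matrices
    over an algebraically closed field, with 0 < r < n, and choose bases in
    which A is the block matrix with blocks 1, 0, 0, 0.  If some B in L has an
    invertible lower right block B22, of size n - r, then the Schur complement
    shows that B + t A is invertible exactly when t avoids the eigenvalues of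
    a certain r x r matrix ([pencil_unitmx]).  As 0 < r, such an eigenvalue t
    exists; then B + t A is a singular element of L, and it still has B22 as
    its lower right block, because A vanishes there.  So its rank is at least
    n - r, whence n - r <= s.  When r = n, the block is empty and the bound
    is trivial.

    It remains to find B.  The lower right blocks of the elements of L form a
    space which is again transitive ([compression_transitive]), so it suffices
    that every transitive space contains an invertible matrix
    ([transitive_has_unit]).  This follows by induction on the size from the
    same pencil: the smaller space of blocks contains an invertible B22, and
    now t is chosen outside the finite set of eigenvalues, so that B + t A is
    invertible. *)

Definition transitive (F : fieldType) (n : nat) (L : {vspace 'M[F]_n}) : Prop :=
  forall x : 'cV[F]_n, x != 0 ->
  forall y : 'cV[F]_n, exists2 A : 'M[F]_n, A \in L & A *m x = y.

(** When G A H has blocks 1, 0, 0, 0, these are the maps from the kernel of A to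
    its cokernel induced by the elements of L.  The block is taken in two
    stages, each of which is a linear map. *)
Definition compression (F : fieldType) (r m : nat) (G H : 'M[F]_(r + m))
    (L : {vspace 'M[F]_(r + m)}) : {vspace 'M[F]_m} :=
  (linfun (rsubmx \o (dsubmx \o (mulmx G \o mulmxr H))) @: L)%VS.

Lemma compressionP (F : fieldType) (r m : nat) (G H : 'M[F]_(r + m))
    (L : {vspace 'M[F]_(r + m)}) (C : 'M[F]_m) :
  reflect (exists2 B, B \in L & C = drsubmx (G *m (B *m H)))
          (C \in compression G H L).
Proof.
rewrite /compression; apply: (iffP memv_imgP) => -[B LB ->]; exists B => //.
  by rewrite lfunE.
by rewrite lfunE.
Qed.

(** To send x to y in the compression, send H (0, x) to G^-1 (0, y) in L. *)
Lemma compression_transitive (F : fieldType) (r m : nat) (G H : 'M[F]_(r + m))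
    (L : {vspace 'M[F]_(r + m)}) :
  G \in unitmx -> H \in unitmx -> transitive L ->
  transitive (compression G H L).
Proof.
move=> uG uH trL x x_neq0 y.
have Hx_neq0 : H *m col_mx 0 x != 0.
  apply: contra_neq x_neq0 => /(congr1 (mulmx (invmx H))).
  by rewrite mulKmx // mulmx0 => /eqP; rewrite col_mx_eq0 => /andP[_ /eqP].
have [B LB BE] := trL _ Hx_neq0 (invmx G *m col_mx 0 y).
exists (drsubmx (G *m (B *m H))); first by apply/compressionP; exists B.
have: G *m (B *m H) *m col_mx 0 x = col_mx 0 y.
  by rewrite -!mulmxA BE mulKVmx.
rewrite -[G *m _ in LHS]submxK mul_block_col !mulmx0 !add0r.
by case/eq_col_mx.
Qed.

Lemma rank_normal_form (F : fieldType) (r m : nat) (A : 'M[F]_(r + m)) :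
  \rank A = r ->
  exists G H, [/\ G \in unitmx, H \in unitmx &
                  G *m (A *m H) = block_mx 1%:M 0 0 0].
Proof.
move=> rA; exists (invmx (col_ebase A)), (invmx (row_ebase A)).
split; rewrite ?unitmx_inv ?col_ebase_unit ?row_ebase_unit //.
rewrite -{2}(mulmx_ebase A) mulmxK ?row_ebase_unit //.
by rewrite mulKmx ?col_ebase_unit // rA pid_mx_block.
Qed.

Lemma unitmx_sub_scalar (F : fieldType) (n : nat) (K : 'M[F]_n) (t : F) :
  (K - t%:M \in unitmx) = ~~ root (char_poly K) t.
Proof.
by rewrite -eigenvalue_root_char negbK kermx_eq0 row_free_unit.
Qed.

(** Column elimination with the invertible block D leaves the Schur complement
    of D on the diagonal. *)
Lemma unitmx_block_schur (F : fieldType) (r m : nat) (A : 'M[F]_r)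
    (B : 'M[F]_(r, m)) (C : 'M[F]_(m, r)) (D : 'M[F]_m) :
  D \in unitmx ->
  (block_mx A B C D \in unitmx) = (A - B *m (invmx D *m C) \in unitmx).
Proof.
move=> uD; pose E := block_mx 1%:M 0 (- (invmx D *m C)) (1%:M : 'M_m).
have uE : E \in unitmx by rewrite unitmxE det_lblock !det1 mulr1 unitr1.
have -> : (block_mx A B C D \in unitmx) = (block_mx A B C D *m E \in unitmx).
  by rewrite unitmx_mul uE andbT.
rewrite mulmx_block !mulmx1 !mulmx0 !add0r !mulmxN mulKVmx // subrr.
by rewrite unitmxE det_ublock unitrM -!unitmxE uD andbT.
Qed.

(** In the given coordinates B + t A has blocks B11 + t, B12, B21, B22; so K is
    the opposite of the Schur complement of B22 in B. *)
Lemma pencil_unitmx (F : fieldType) (r m : nat) (G H A B : 'M[F]_(r + m)) :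
  G \in unitmx -> H \in unitmx -> G *m (A *m H) = block_mx 1%:M 0 0 0 ->
  drsubmx (G *m (B *m H)) \in unitmx ->
  exists K : 'M[F]_r,
    forall t, (B + t *: A \in unitmx) = ~~ root (char_poly K) t.
Proof.
move=> uG uH AE; set M := G *m (B *m H) => uM.
exists (- (ulsubmx M - ursubmx M *m (invmx (drsubmx M) *m dlsubmx M))) => t.
have -> : (B + t *: A \in unitmx) = (G *m ((B + t *: A) *m H) \in unitmx).
  by rewrite !unitmx_mul uG uH andbT.
rewrite mulmxDl mulmxDr -scalemxAl -scalemxAr AE -/M -[M in LHS]submxK.
rewrite scale_block_mx add_block_mx !scaler0 !addr0 unitmx_block_schur //.
rewrite -unitmx_sub_scalar -opprD -!row_free_unit /row_free mxrank_opp.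
by rewrite scalemx1 addrAC.
Qed.

Lemma rank_drsubmx (F : fieldType) (r m : nat) (M : 'M[F]_(r + m)) :
  (\rank (drsubmx M) <= \rank M)%N.
Proof.
have -> : drsubmx M = row_mx 0 1%:M *m (M *m col_mx 0 1%:M).
  rewrite -[M in RHS]submxK mul_block_col mul_row_col.
  by rewrite !mulmx0 mul0mx mul1mx mulmx1 !add0r.
exact: leq_trans (mxrankM_maxr _ _) (mxrankM_maxl _ _).
Qed.

Lemma transitive_neq0 (F : fieldType) (n : nat) (L : {vspace 'M[F]_n}) :
  (0 < n)%N -> transitive L -> exists2 A, A \in L & A != 0.
Proof.
case: n L => // n L _ trL.
have nz : const_mx 1 != 0 :> 'cV[F]_n.+1.
  by apply/eqP => /matrixP/(_ 0 0)/eqP; rewrite !mxE oner_eq0.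
have [A LA Ax] := trL _ nz (const_mx 1).
by exists A => //; apply: contra_neq nz => A0; rewrite -Ax A0 mul0mx.
Qed.

(** An algebraically closed field is infinite, so some t is not an eigenvalue,
    and the pencil B + t A through a block supplied by induction contains an
    invertible matrix. *)
Lemma transitive_has_unit (F : closedFieldType) (n : nat)
    (L : {vspace 'M[F]_n}) :
  transitive L -> exists2 A, A \in L & A \in unitmx.
Proof.
elim/ltn_ind: n L => n IHn L trL.
have [n_eq0|n_gt0] := posnP n.
  (* The empty matrix is invertible. *)
  by subst n; exists 0; rewrite ?mem0v // unitmxE det_mx00 unitr1.
have [A LA A_neq0] := transitive_neq0 n_gt0 trL.
have [r rA] : exists r, \rank A = r by exists (\rank A).
have r_gt0 : (0 < r)%N by rewrite -rA lt0n mxrank_eq0.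
have [m nE] : exists m, n = (r + m)%N.
  by exists (n - r)%N; rewrite subnKC // -rA rank_leq_row.
subst n.
have [G [H [uG uH AE]]] := rank_normal_form rA.
have m_lt : (m < r + m)%N by rewrite -{1}[m]add0n ltn_add2r.
have [_ /compressionP[B LB ->] uB] :=
  IHn m m_lt _ (compression_transitive uG uH trL).
have [K unitE] := pencil_unitmx uG uH AE uB.
have [t Kt] := closed_nonrootP _ (monic_neq0 (char_poly_monic K)).
by exists (B + t *: A); rewrite ?unitE // memvD // memvZ.
Qed.

Lemma transitive_singular_rank_ge (F : closedFieldType) (r m : nat)
    (L : {vspace 'M[F]_(r + m)}) (A : 'M[F]_(r + m)) :
  transitive L -> A \in L -> \rank A = r -> (0 < r)%N ->
  exists B, [/\ B \in L, B \notin unitmx & (m <= \rank B)%N].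
Proof.
move=> trL LA rA r_gt0; have [G [H [uG uH AE]]] := rank_normal_form rA.
have [_ /compressionP[B LB ->] uB] :=
  transitive_has_unit (compression_transitive uG uH trL).
have [K unitE] := pencil_unitmx uG uH AE uB.
have [t Kt] : exists t, root (char_poly K) t.
  by apply/closed_rootP; rewrite size_char_poly eqSS -lt0n.
exists (B + t *: A); split; rewrite ?unitE ?negbK ?memvD ?memvZ //.
(* The lower right block does not see the multiple of A. *)
have drE : drsubmx (G *m ((B + t *: A) *m H)) = drsubmx (G *m (B *m H)).
  rewrite mulmxDl mulmxDr -scalemxAl -scalemxAr AE.
  by rewrite /drsubmx !(linearD, linearZ) /= -![rsubmx (dsubmx _)]/(drsubmx _) block_mxKdr scaler0 addr0.
rewrite -{1}(mxrank_unit uB) -drE (leq_trans (rank_drsubmx _)) //.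
exact: leq_trans (mxrankM_maxr _ _) (mxrankM_maxl _ _).
Qed.

Theorem proposition5p2 (R : realType) (n : nat) (L : {vspace 'M[R[i]]_n})
    (r s : nat) :
  (1 <= n)%N ->
  transitive_space L ->
  is_min_nonzero_rank L r ->
  is_max_singular_rank L s ->
  (n <= r + s)%N.
Proof.
move=> _ trL [[A [LA A_neq0 rA]] _] [_ s_max].
have r_gt0 : (0 < r)%N by rewrite -rA lt0n mxrank_eq0.
have [m nE] : exists m, n = (r + m)%N.
  by exists (n - r)%N; rewrite subnKC // -rA rank_leq_row.
subst n.
have [B [LB nuB mB]] := transitive_singular_rank_ge trL LA rA r_gt0.
by rewrite leq_add2l (leq_trans mB) // s_max.
Qed.
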